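(* Let $n\ge 1$ be an integer and let $\lambda_0,\lambda_1,\lambda_2\in\mathbb{C}$ be such that all the zeros of $u(z)=\lambda_0+\binom{n}{1}\lambda_1 z+\binom{n}{2}\lambda_2 z^2$ lie in the half plane $\{z\in\mathbb{C}: |z|\le |z-\tfrac n2|\}$. Let $B$ be the associated operator on polynomials of degree at most $n$, $B[P(z)]=\lambda_0P(z)+\lambda_1\left(\frac{nz}{2}\right)\frac{P'(z)}{1!}+\lambda_2\left(\frac{nz}{2}\right)^2\frac{P''(z)}{2!}$. If $P(z)$ is a polynomial of degree $n$ with complex coefficients which does not vanish in $|z|<1$, then for every real $R\ge 1$ and every $z\in\mathbb{C}$ with $|z|\ge 1$, $$|B[P(Rz)]|\le\frac12\left\{R^n|B[z^n]|+|\lambda_0|\right\}\max_{|w|=1}|P(w)|.$$ The result is sharp: equality is attained for $P(z)=z^n+1$ (at some point $z$ with $|z|\ge 1$).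
   Context: $B$ is applied to polynomials in the variable $z$: $B[P(Rz)]$ denotes the result of applying $B$ to the polynomial $z\mapsto P(Rz)$, evaluated at $z$ (so derivatives are taken with respect to $z$), and $B[z^n]$ denotes $B$ applied to the monomial $z^n$, evaluated at $z$. The integer $n$ in the definition of $B$ is the same $n$ as the degree of $P$. *)

(* Defs.v *)
From mathcomp Require Import all_boot all_order all_algebra.
From mathcomp Require Import all_classical all_reals.
From mathcomp Require Export complex.

Set Implicit Arguments.
Unset Strict Implicit.
Unset Printing Implicit Defensive.

Import Order.TTheory GRing.Theory Num.Theory.

Local Open Scope classical_set_scope.
Local Open Scope ring_scope.
Local Open Scope complex_scope.

(* The complex numbers are K[i] for K : realType.  The norm `|z| of K[i] takes
   its values in K[i]; cmod is the same modulus as an element of K. *)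
Definition cmod (K : realType) (z : K[i]) : K := complex.Re `|z|.

(* The set is nonempty and bounded, and by compactness of the unit circle the
   supremum is attained: it is the maximum of |P(w)| over |w| = 1. *)
Definition max_circle (K : realType) (P : {poly K[i]}) : K :=
  sup [set cmod P.[w] | w in [set w : K[i] | cmod w = 1]].

Definition upoly (K : realType) (n : nat) (l0 l1 l2 : K[i]) : {poly K[i]} :=
  l0%:P + ('C(n, 1)%:R * l1) *: 'X + ('C(n, 2)%:R * l2) *: 'X^2.

(* Defined on all polynomials; only meant for those of degree at most n. *)
Definition Bop (K : realType) (n : nat) (l0 l1 l2 : K[i]) (P : {poly K[i]}) :
    {poly K[i]} :=
  l0 *: P
  + l1 *: (((n%:R / 2%:R) *: 'X) * ((1`!)%:R^-1 *: P^`()))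
  + l2 *: (((n%:R / 2%:R) *: 'X) ^+ 2 * ((2`!)%:R^-1 *: P^`(2))).

(* The polynomial z |-> P(r z), for a real r. *)
Definition dilate (K : realType) (r : K) (P : {poly K[i]}) : {poly K[i]} :=
  P \Po (r%:C *: 'X).

(* Main.v *)
Require Import Defs.
From mathcomp Require Import all_boot all_order all_algebra.
From mathcomp Require Import all_classical all_reals.
From mathcomp Require Import zify ring lra.

(** The operator [Bop] sends a polynomial of degree [n] with all its zeros in
    the disc [cmod w <= 1] to a polynomial that does not vanish for
    [cmod z > 1] ([Bop_neq0]). This is the only place where the condition on
    the zeros of [upoly] enters: at a point [z], [Bop P / P] is the polarization
    of [upoly] evaluated at the numbers [(n / 2) z / (z - a)], [a] ranging over
    the zeros of [P]; these lie in an open half plane where [upoly] has no zero,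
    and a symmetric multi-affine function cannot then vanish, by Walsh's
    coincidence theorem. As [upoly] has degree at most two, that theorem reduces
    here to a property of quadratic forms of Lorentzian signature
    ([lorentzian_neq0]).

    Applied to [P - a *: Q] with [cmod a > 1], this turns the domination of [P]
    by [Q] outside the disc into the domination of [Bop P] by [Bop Q]
    ([Bop_le]). Let [P] have no zero in the open disc, let [Q] be its conjugate
    reciprocal [recip n P] and [M] its maximum on the circle. Then [Bop_le] is
    used three times, at points with [cmod z >= 1]:
    - [P] is dominated by [Q], so [cmod (Bop P) <= cmod (Bop Q)];
    - [Q] is dominated by [M * 'X^n], by the maximum modulus principle, so
      [cmod (Bop Q) <= M * cmod (Bop 'X^n)];
    - [P + c], with [c] a constant of modulus slightly larger than [M], has no
      zero in the disc either, and its reciprocal is [Q + conjc c *: 'X^n]; the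
      right choice of the argument of [c] yields
      [cmod (Bop P) + cmod (Bop Q) <= (cmod (Bop 'X^n) + cmod l0) * M].
    The first and the last bound give the result for [r = 1], and [Bop]
    commutes with dilations. For ['X^n + 1] both sides are explicit, and the two
    terms of [Bop ('X^n + 1)] have the same argument at a suitable point of the
    circle.

    The maximum modulus principle is obtained for polynomials without
    integration: the coefficients are bounded by the maximum on the circle, and
    this crude bound is applied to the powers of the polynomial. *)

Import Order.TTheory GRing.Theory Num.Theory.

Set Implicit Arguments.
Unset Strict Implicit.
Unset Printing Implicit Defensive.

Local Open Scope ring_scope.
Local Open Scope complex_scope.

(** * The real-valued modulus *)

Lemma normc_cmod (K : realType) (z : K[i]) : `|z| = (cmod z)%:C.
Proof. by rewrite /cmod normc_def. Qed.

Lemma cmodE (K : realType) (z : K[i]) :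
  cmod z = Num.sqrt (complex.Re z ^+ 2 + complex.Im z ^+ 2).
Proof. by rewrite /cmod normc_def. Qed.

Lemma sqr_cmod (K : realType) (z : K[i]) :
  cmod z ^+ 2 = complex.Re z ^+ 2 + complex.Im z ^+ 2.
Proof. by rewrite cmodE sqr_sqrtr // addr_ge0 // sqr_ge0. Qed.

Lemma cmod_ge0 (K : realType) (z : K[i]) : 0 <= cmod z.
Proof. by rewrite cmodE sqrtr_ge0. Qed.

Lemma cmodM (K : realType) (x y : K[i]) : cmod (x * y) = cmod x * cmod y.
Proof. by apply: complexI; rewrite rmorphM -!normc_cmod normrM. Qed.

Lemma cmod0 (K : realType) : cmod (0 : K[i]) = 0.
Proof. by rewrite /cmod normr0. Qed.

Lemma cmod1 (K : realType) : cmod (1 : K[i]) = 1.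
Proof. by rewrite /cmod normr1. Qed.

Lemma cmod_eq0 (K : realType) (z : K[i]) : (cmod z == 0) = (z == 0).
Proof. by rewrite -(inj_eq (@complexI K)) -normc_cmod normr_eq0. Qed.

Lemma cmod_gt0 (K : realType) (z : K[i]) : (0 < cmod z) = (z != 0).
Proof. by rewrite lt_def cmod_ge0 andbT cmod_eq0. Qed.

Lemma cmodX (K : realType) (z : K[i]) k : cmod (z ^+ k) = cmod z ^+ k.
Proof. by elim: k => [|k IH]; rewrite ?expr0 ?cmod1 // !exprS cmodM IH. Qed.

Lemma cmodV (K : realType) (z : K[i]) : cmod z^-1 = (cmod z)^-1.
Proof. by apply: complexI; rewrite fmorphV -!normc_cmod normfV. Qed.

Lemma cmodN (K : realType) (z : K[i]) : cmod (- z) = cmod z.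
Proof. by rewrite /cmod normrN. Qed.

Lemma cmodJ (K : realType) (z : K[i]) : cmod (conjc z) = cmod z.
Proof. by rewrite /cmod normcJ. Qed.

Lemma cmod_real (K : realType) (x : K) : 0 <= x -> cmod x%:C = x.
Proof. by move=> x0; rewrite cmodE /= expr0n addr0 sqrtr_sqr ger0_norm. Qed.

Lemma cmod_nat (K : realType) k : cmod (k%:R : K[i]) = k%:R.
Proof.
have -> : k%:R = (k%:R : K)%:C by rewrite rmorph_nat.
by rewrite cmod_real ?ler0n.
Qed.

Lemma ler_cmodD (K : realType) (x y : K[i]) : cmod (x + y) <= cmod x + cmod y.
Proof. by rewrite -lecR rmorphD /= -!normc_cmod ler_normD. Qed.

Lemma ler_cmodB (K : realType) (x y : K[i]) : cmod x - cmod y <= cmod (x + y).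
Proof.
by have := ler_cmodD (x + y) (- y); rewrite addrK cmodN -lerBlDr.
Qed.

Lemma ler_cmod_sqr (K : realType) (x y : K[i]) :
  (cmod x <= cmod y) = (cmod x ^+ 2 <= cmod y ^+ 2).
Proof. by rewrite ler_pXn2r // nnegrE cmod_ge0. Qed.

Lemma ler_cmod_sum (K : realType) (I : Type) (s : seq I) (F : I -> K[i]) :
  cmod (\sum_(i <- s) F i) <= \sum_(i <- s) cmod (F i).
Proof.
elim: s => [|a s IH]; first by rewrite !big_nil cmod0.
by rewrite !big_cons; apply: le_trans (ler_cmodD _ _) _; rewrite lerD2l.
Qed.

Lemma cmod_phase (K : realType) (z : K[i]) :
  exists v : K[i], cmod v = 1 /\ z = (cmod z)%:C * v.
Proof.
have [->|z0] := eqVneq z 0; first by exists 1; rewrite cmod1 cmod0 mul0r.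
have z1 : (cmod z)%:C != 0 by rewrite fmorph_eq0 cmod_eq0.
exists (z * ((cmod z)%:C)^-1); split.
  by rewrite cmodM cmodV cmod_real ?cmod_ge0 // divff // cmod_eq0.
by rewrite mulrCA divff ?mulr1.
Qed.

(** * Maximum modulus for polynomials *)

(** On the circle [even_poly f] and [odd_poly f] at [w ^+ 2] are the averages
    [(f w + f (- w)) / 2] and [(f w - f (- w)) / (2 w)], so they inherit the
    bound [M]; the coefficients of [f] are theirs, with half the degree. *)
Lemma coef_le_circle (K : realType) (f : {poly K[i]}) (M : K) :
  (forall w : K[i], cmod w = 1 -> cmod f.[w] <= M) ->
  forall k, cmod f`_k <= M.
Proof.
have [m] := ubnP (size f); elim: m f => // m IH f szf fM k.
have [sz1|sz1] := leqP (size f) 1.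
  have fC := size1_polyC sz1.
  have f0M : cmod f`_0 <= M.
    by have := fM 1 (cmod1 K); rewrite {1}fC hornerC.
  case: k => // k; rewrite nth_default ?cmod0 ?(leq_trans sz1) //.
  exact: le_trans (cmod_ge0 _) f0M.
have sqrt_circle (w : K[i]) : cmod w = 1 ->
    exists2 v : K[i], cmod v = 1 & v ^+ 2 = w.
  move=> w1; exists (sqrtC w); last exact: sqrtCK.
  apply/eqP; rewrite -(@eqrXn2 _ 2) ?cmod_ge0 // -cmodX sqrtCK w1 expr1n //.
have fE (v : K[i]) : f.[v] = (even_poly f).[v ^+ 2] + (odd_poly f).[v ^+ 2] * v.
  by rewrite -{1}(poly_even_odd f) !(hornerE, horner_comp).
have half2 (x y : K[i]) : cmod x <= M -> cmod y <= M -> 2 * M >= cmod (x + y).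
  by move=> xM yM; apply: le_trans (ler_cmodD _ _) _; lra.
have cmod2 (x : K[i]) : cmod (x *+ 2) = 2 * cmod x.
  by rewrite -[x *+ 2]mulr_natl cmodM cmod_nat.
have evenM (w : K[i]) : cmod w = 1 -> cmod (even_poly f).[w] <= M.
  case/sqrt_circle => v v1 <-.
  have := half2 _ _ (fM v v1) (fM (- v) _); rewrite cmodN => /(_ v1).
  rewrite !fE sqrrN [X in cmod X](_ : _ = (even_poly f).[v ^+ 2] *+ 2); last by ring.
  by rewrite cmod2; lra.
have oddM (w : K[i]) : cmod w = 1 -> cmod (odd_poly f).[w] <= M.
  case/sqrt_circle => v v1 <-.
  have := half2 f.[v] (- f.[- v]) (fM v v1); rewrite cmodN => /(_ (fM (- v) _)).
  rewrite cmodN => /(_ v1).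
  rewrite !fE sqrrN [X in cmod X](_ : _ = ((odd_poly f).[v ^+ 2] * v) *+ 2); last by ring.
  by rewrite cmod2 cmodM v1 mulr1; lra.
rewrite -(odd_double_half k); case: (odd k) => /=.
- rewrite add1n -coef_odd_poly; apply: IH => //.
  by apply: leq_ltn_trans (size_odd_poly _) _; lia.
- rewrite add0n -coef_even_poly; apply: IH => //.
  by apply: leq_ltn_trans (size_even_poly _) _; lia.
Qed.

Lemma horner_le_coef (K : realType) (f : {poly K[i]}) (M : K) (z : K[i]) :
  (forall k, cmod f`_k <= M) -> cmod z <= 1 -> cmod f.[z] <= (size f)%:R * M.
Proof.
move=> fM z1; rewrite horner_coef; apply: le_trans (ler_cmod_sum _ _) _.
rewrite -[X in _ <= X%:R * _]card_ord mulr_natl -sumr_const.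
apply: ler_sum => i _; rewrite cmodM cmodX -[leRHS]mulr1.
by apply: ler_pM; rewrite ?cmod_ge0 ?exprn_ge0 ?exprn_ile1 ?cmod_ge0.
Qed.

(** A quantity whose powers grow at most linearly is at most [1]: the
    quadratic term of the binomial expansion of [(1 + h) ^+ m] wins. *)
Lemma le1_of_linear_powers (K : realType) (x a b : K) :
  (forall m, x ^+ m <= a + b * m%:R) -> x <= 1.
Proof.
move=> xm; rewrite leNgt; apply/negP => x1.
pose h := x - 1; have h0 : 0 < h by rewrite subr_gt0.
have quad m : 1 + h * m%:R + h ^+ 2 / 2 * (m%:R * (m%:R - 1)) <= x ^+ m.
  have -> : x = 1 + h by rewrite /h; ring.
  elim: m => [|m IH]; first by rewrite expr0; lra.
  have h1 : 0 <= 1 + h by lra.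
  rewrite [(1 + h) ^+ _]exprSr; apply: le_trans _ (ler_wpM2r h1 IH).
  rewrite -[m.+1]addn1 natrD /=; move: (ler0n K m) => m0.
  rewrite -subr_ge0.
  have -> : (1 + h * m%:R + h ^+ 2 / 2 * (m%:R * (m%:R - 1))) * (1 + h)
     - (1 + h * (m%:R + 1) + h ^+ 2 / 2 * ((m%:R + 1) * (m%:R + 1 - 1)))
     = h ^+ 3 / 2 * (m%:R * (m%:R - 1)) by field.
  apply: mulr_ge0; first by rewrite divr_ge0 ?exprn_ge0 ?ltW.
  case: {IH} m m0 => [|m] m0; first by rewrite mul0r.
  by rewrite mulr_ge0 // subr_ge0 ler1n.
pose c := h ^+ 2 / 2; have c0 : 0 < c by rewrite divr_gt0 ?exprn_gt0.
(* [t] makes [c * u * (u - 1)] exceed [a + b * u] for all [u >= t]. *)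
pose t := (`|a| + `|b| + 1) / c + 1.
have t0 : 1 <= t by rewrite lerDr divr_ge0 ?addr_ge0 // ltW.
have ct : c * (t - 1) = `|a| + `|b| + 1.
  by rewrite /t addrK mulrC divfK // gt_eqF.
have [m tm] : exists m : nat, t <= m%:R.
  exists (Num.truncn t).+1; apply: ltW.
  exact: Num.Theory.truncnS_gt.
have := le_trans (quad m) (xm m); rewrite -/c.
have am := ler_norm a; have bm := ler_norm b.
have a0 := normr_ge0 a; have b0 := normr_ge0 b.
set u : K := m%:R in tm *.
have u1 : 1 <= u by lra.
have : c * (u * (t - 1)) <= c * (u * (u - 1)).
  by rewrite ler_pM2l // ler_wpM2l //; lra.
have -> : c * (u * (t - 1)) = u * (c * (t - 1)) by ring.
rewrite ct => le1 le2.
have hu : 0 <= h * u by apply: mulr_ge0; lra.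
have e1 : b * u <= `|b| * u by apply: ler_wpM2r; lra.
have e2 : `|a| <= u * `|a| by rewrite ler_peMl.
nra.
Qed.

(** Bounding [f ^+ m] by its coefficients only loses the factor
    [size (f ^+ m)], linear in [m], which taking the [m]-th root absorbs. *)
Lemma maximum_modulus (K : realType) (f : {poly K[i]}) (M : K) :
  (forall w : K[i], cmod w = 1 -> cmod f.[w] <= M) ->
  forall z : K[i], cmod z <= 1 -> cmod f.[z] <= M.
Proof.
move=> fM z z1.
have M0 : 0 <= M by apply: le_trans (fM 1 (cmod1 K)); exact: cmod_ge0.
have powM m : cmod f.[z] ^+ m <= (size (f ^+ m))%:R * M ^+ m.
  rewrite -cmodX -horner_exp; apply: horner_le_coef => //.
  apply: coef_le_circle => w w1; rewrite horner_exp cmodX.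
  by rewrite lerXn2r ?nnegrE ?cmod_ge0 ?fM.
have [M1|M1] := eqVneq M 0.
  have := horner_le_coef (coef_le_circle fM) z1.
  by rewrite M1 mulr0.
have Mgt0 : 0 < M by rewrite lt_def M1.
rewrite -[M]mul1r -ler_pdivrMr //.
apply: (@le1_of_linear_powers _ _ 1 (size f)%:R) => m.
rewrite expr_div_n ler_pdivrMr ?exprn_gt0 //.
apply: le_trans (powM m) _; rewrite ler_wpM2r ?exprn_ge0 //.
apply: le_trans (_ : (((size f).-1 * m).+1)%:R <= _).
  by rewrite ler_nat size_poly_exp_leq.
rewrite -natr1 natrM addrC lerD2l ler_wpM2r ?ler0n // ler_nat.
exact: leq_pred.
Qed.

(** * Zeros of [Bop P] *)

Lemma Re_sum (K : realType) (s : seq K[i]) :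
  complex.Re (\sum_(z <- s) z) = \sum_(z <- s) complex.Re z.
Proof.
elim: s => [|[a b] s IH]; rewrite ?big_nil // !big_cons -IH.
by case: (\sum_(z <- s) z).
Qed.

Lemma Im_sum (K : realType) (s : seq K[i]) :
  complex.Im (\sum_(z <- s) z) = \sum_(z <- s) complex.Im z.
Proof.
elim: s => [|[a b] s IH]; rewrite ?big_nil // !big_cons -IH.
by case: (\sum_(z <- s) z).
Qed.

(** Positivity of the form of [lorentzian_neq0] on its cone: expanded, the right
    side is the sum of the [size s * (size s - 1)] products of two distinct
    [f i], each larger than [d ^+ 2]. *)
Lemma sqr_sum_gt (K : realType) (I : eqType) (s : seq I) (f : I -> K) (d : K) :
  (1 < size s)%N -> (forall i, i \in s -> `|d| < f i) ->
  (size s)%:R * ((size s)%:R - 1) * d ^+ 2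
    < (\sum_(i <- s) f i) ^+ 2 - \sum_(i <- s) f i ^+ 2.
Proof.
have d2 : d ^+ 2 = `|d| ^+ 2 by rewrite real_normK ?num_real.
rewrite d2; have := normr_ge0 d; set e := `|d| => e0.
have weak (r : seq I) : (forall i, i \in r -> e < f i) ->
    (size r)%:R * e <= \sum_(i <- r) f i /\
    (size r)%:R * ((size r)%:R - 1) * e ^+ 2
      <= (\sum_(i <- r) f i) ^+ 2 - \sum_(i <- r) f i ^+ 2.
  elim: r => [|a r IH] fr; first by rewrite !big_nil expr0n /= !mul0r subrr.
  have fa : e < f a by apply: fr; rewrite mem_head.
  have [|le1 le2] := IH; first by move=> i ir; apply: fr; rewrite inE ir orbT.
  rewrite !big_cons /= -natr1; move: (ler0n K (size r)) => k0.
  set k : K := (size r)%:R in le1 le2 k0 *.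
  set S := \sum_(j <- r) f j in le1 le2 *.
  set T := \sum_(j <- r) f j ^+ 2 in le2 *.
  split; first by lra.
  have ke : 0 <= k * e by rewrite mulr_ge0.
  have : k * e * e <= S * f a by apply: ler_pM => //; apply: ltW.
  by nra.
case: s => [//|a [//|b s]] _ fs.
have fa : e < f a by apply: fs; rewrite mem_head.
have [|le1 le2] := weak (b :: s).
  by move=> i ir; apply: fs; rewrite inE ir orbT.
have fb : e < f b by apply: fs; rewrite !inE eqxx orbT.
have [|le3 _] := weak s.
  by move=> i ir; apply: fs; rewrite !inE ir !orbT.
rewrite big_cons [X in _ < _ - X]big_cons [size (a :: _)]/= -natr1.
have lt4 : (size (b :: s))%:R * e < \sum_(j <- b :: s) f j.
  by rewrite big_cons /= -natr1; lra.
have k0 : 0 <= ((size (b :: s))%:R : K) by exact: ler0n.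
set k : K := (size (b :: s))%:R in le1 le2 k0 lt4 *.
set S := \sum_(j <- b :: s) f j in le1 le2 lt4 *.
set T := \sum_(j <- b :: s) f j ^+ 2 in le2 *.
have ke : 0 <= k * e by rewrite mulr_ge0.
have : k * e * e < S * f a.
  apply: le_lt_trans (_ : k * e * f a < _); first by rewrite ler_wpM2l // ltW.
  by rewrite ltr_pM2r //; lra.
by nra.
Qed.

(** The left side is a quadratic form [q] with real coefficients in the vector
    formed by [s] and [d]; let [x + i y] be that vector. By hypothesis [x] is in
    the cone where [q] is positive. If [q] vanished at [x + i y], then [q y]
    would equal [q x], hence be positive, and [x], [y] would be [q]-orthogonal;
    the two facts make [q] positive at every [y - l x]. But for a suitable [l]
    the [s]-coordinates of [y - l x] sum to zero, and there [q] is nonpositive. *)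
Lemma lorentzian_neq0 (K : realType) (s : seq K[i]) (d : K[i]) :
  (1 < size s)%N ->
  (forall z, z \in s -> `|complex.Re d| < complex.Re z) ->
  (\sum_(z <- s) z) ^+ 2 - \sum_(z <- s) z ^+ 2
    - (size s)%:R * ((size s)%:R - 1) * d ^+ 2 != 0.
Proof.
move=> s2 sd; apply/eqP => q0.
have pos := sqr_sum_gt s2 sd.
have X0 : 0 < \sum_(z <- s) complex.Re z.
  case: s s2 sd {q0 pos} => [//|a s] _ sd.
  rewrite big_cons ltr_pwDl //.
    by apply: le_lt_trans (sd a _); rewrite ?mem_head.
  rewrite big_seq; apply: sumr_ge0 => z zs; apply: ltW.
  by apply: le_lt_trans (sd z _) => //; rewrite inE zs orbT.
set N : K := (size s)%:R * ((size s)%:R - 1) in pos.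
have N0 : 0 <= N by rewrite mulr_ge0 // subr_ge0 ler1n ltnW.
have NE : (size s)%:R * ((size s)%:R - 1) = N%:C :> K[i].
  by rewrite /N rmorphM rmorphB /= !rmorph_nat.
set X := \sum_(z <- s) complex.Re z in X0 pos.
set A := \sum_(z <- s) complex.Re z ^+ 2 in pos.
pose Y := \sum_(z <- s) complex.Im z.
pose B := \sum_(z <- s) complex.Re z * complex.Im z.
pose C := \sum_(z <- s) complex.Im z ^+ 2.
have sumE : \sum_(z <- s) z = X +i* Y.
  by rewrite [LHS]complexE Re_sum Im_sum [RHS]complexE.
have sum2E : \sum_(z <- s) z ^+ 2 = (A - C) +i* (B *+ 2).
  rewrite /A /B /C; elim: (s) => [|[a b] r IH]; first by rewrite !big_nil subrr mul0rn.
  rewrite !big_cons IH expr2; apply/eqP; rewrite eq_complex /=.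
  by apply/andP; split; apply/eqP; ring.
(* minus the value of [q] at [y - l x], apart from the square of the sum and
   the term in [d] *)
have lag (l : K) : 0 <= C - l * B *+ 2 + l ^+ 2 * A.
  apply: le_trans (_ : \sum_(z <- s) (complex.Im z - l * complex.Re z) ^+ 2 <= _).
    by apply: sumr_ge0 => z _; rewrite sqr_ge0.
  rewrite le_eqVlt; apply/orP; left; apply/eqP.
  rewrite /A /B /C; elim: (s) => [|z r IH]; first by rewrite !big_nil; ring.
  by rewrite !big_cons IH; ring.
have := lag (Y / X); have : 0 <= N * (complex.Im d - Y / X * complex.Re d) ^+ 2.
  by rewrite mulr_ge0 ?sqr_ge0.
have : Y = Y / X * X by rewrite divfK ?gt_eqF.
move: q0; rewrite sumE sum2E NE !expr2 => /eqP; rewrite eq_complex /=.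
case: (d) pos => [e g] /= pos; case/andP => /eqP re /eqP im.
set l := Y / X => Yl.
move: re im; rewrite {}Yl !mul0r ?add0r ?subr0 ?addr0 => re im.
have l2 := sqr_ge0 l.
set W := A + N * e ^+ 2; have WX : W < X ^+ 2 by rewrite /W; lra.
have : 0 <= l ^+ 2 * (X ^+ 2 - W) by rewrite mulr_ge0 // subr_ge0 ltW.
rewrite /W in WX *.
have imE : l * X ^+ 2 = B + N * e * g by lra.
have im2 : l * (l * X ^+ 2) = l * (B + N * e * g) by rewrite imE.
nra.
Qed.

Lemma half_planeE (K : realType) (h : K) (t : K[i]) : 0 < h ->
  (cmod t <= cmod (t - h%:C)) = (complex.Re t <= h / 2).
Proof.
move=> h0; rewrite ler_cmod_sqr !sqr_cmod; case: t => a b /=; rewrite subr0.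
by apply/idP/idP => ?; nra.
Qed.

(** Newton's identity in degree two: the quotients [p' / p] and [p'' / p] are
    [e1] and [2 e2] of the numbers [1 / (z - a)], here written with power sums. *)
Lemma deriv_prod_XsubC (F : fieldType) (rs : seq F) (z : F) :
  z \notin rs ->
  let p := \prod_(a <- rs) ('X - a%:P) in
  let S1 := \sum_(a <- rs) (z - a)^-1 in
  let S2 := \sum_(a <- rs) (z - a)^-1 ^+ 2 in
  p^`().[z] = p.[z] * S1 /\ p^`()^`().[z] = p.[z] * (S1 ^+ 2 - S2).
Proof.
move=> zrs; cbv zeta.
elim: rs zrs => [|a rs IH].
  by rewrite !big_nil derivC deriv0 !hornerE expr0n subrr.
rewrite inE negb_or -subr_eq0 => /andP[za /IH []].
have dE (p : {poly F}) : (('X - a%:P) * p)^`() = p + ('X - a%:P) * p^`().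
  by rewrite derivM derivXsubC mul1r.
rewrite !big_cons /= !dE derivD dE.
set p := \prod_(j <- rs) _; set S1 := \sum_(j <- rs) _; set S2 := \sum_(j <- rs) _.
by rewrite !hornerE /= => -> ->; split; field.
Qed.

Lemma BopE (K : realType) n (l0 l1 l2 : K[i]) P z :
  (Bop n l0 l1 l2 P).[z] = l0 * P.[z] + l1 * (n%:R / 2%:R * z * P^`().[z])
    + l2 * ((n%:R / 2%:R * z) ^+ 2 * (P^`()^`().[z] / 2%:R)).
Proof. by rewrite /Bop (_ : 1`! = 1%N) // (_ : 2`! = 2%N) // !hornerE /=; field. Qed.

Lemma bin2_natr (F : numFieldType) n :
  'C(n, 2)%:R = n%:R * (n%:R - 1) / 2%:R :> F.
Proof.
elim: n => [|n IH]; first by rewrite bin0n !mul0r.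
by rewrite binS natrD IH bin1 -natr1; field.
Qed.

Lemma Re_divn (K : realType) (t : K[i]) n :
  complex.Re (t / n%:R) = complex.Re t / n%:R.
Proof.
have -> : n%:R^-1 = (n%:R^-1)%:C :> K[i] by rewrite fmorphV rmorph_nat.
by case: t => a b /=; rewrite mulr0 subr0.
Qed.

(** By [half_planeE], the half plane that contains the zeros of [upoly] is
    [complex.Re z <= n / 4]. *)
Lemma upoly_neq0 (K : realType) n (l0 l1 l2 : K[i]) :
  (1 <= n)%N ->
  (forall z : K[i], root (upoly n l0 l1 l2) z ->
     cmod z <= cmod (z - n%:R / 2%:R)) ->
  forall t : K[i], n%:R / 4 < complex.Re t ->
    l0 + n%:R * l1 * t + 'C(n, 2)%:R * l2 * t ^+ 2 != 0.
Proof.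
move=> n0 hu t ht; apply/negP => /eqP ut.
have {}ut : root (upoly n l0 l1 l2) t.
  by rewrite /root /upoly !hornerE bin1 /= -ut; apply/eqP; ring.
have n0K : 0 < n%:R / 2 :> K by rewrite divr_gt0 ?ltr0n.
have := hu t ut.
have -> : n%:R / 2%:R = (n%:R / 2)%:C :> K[i] by rewrite rmorphM fmorphV /= !rmorph_nat.
by rewrite half_planeE // => ht'; lra.
Qed.

Lemma quadratic_split (F : numClosedFieldType) (a b c : F) : a != 0 ->
  exists t1 t2, c = a * (t1 * t2) /\ b = - (a * (t1 + t2)).
Proof.
move=> a0; have := sqrtCK (b ^+ 2 - 4 * a * c); set w := sqrtC _ => w2.
exists ((- b + w) / (2 * a)), ((- b - w) / (2 * a)).
split; last by field.
have -> : a * ((- b + w) / (2 * a) * ((- b - w) / (2 * a)))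
  = (b ^+ 2 - w ^+ 2) / (4 * a) by field.
by rewrite w2; field.
Qed.

(** If [P] splits with roots [a], the identities of [deriv_prod_XsubC] express
    [Bop P / P] at [z] as a quadratic polynomial in the power sums of
    [x_a = (n / 2) z / (z - a)], and [cmod a < cmod z] says that [x_a] lies in
    the half plane free of zeros of [upoly]. That polynomial is the
    polarization of [upoly]. When [upoly] has degree at most one, its value is
    that of [upoly] at the mean of the [x_a]; when [upoly] has zeros [t1] and
    [t2], the translation by [(t1 + t2) / 2] turns it into the Lorentzian form
    of [lorentzian_neq0]. *)
Lemma Bop_neq0 (K : realType) n (l0 l1 l2 : K[i]) :
  (1 <= n)%N ->
  (forall z : K[i], root (upoly n l0 l1 l2) z ->
     cmod z <= cmod (z - n%:R / 2%:R)) ->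
  forall (P : {poly K[i]}) (z : K[i]), size P = n.+1 ->
    (forall w, root P w -> cmod w < cmod z) ->
    (Bop n l0 l1 l2 P).[z] != 0.
Proof.
move=> n0 hu P z szP Pz; have unz := upoly_neq0 n0 hu.
have [rs PE] := closed_field_poly_normal P.
have P0 : P != 0 by rewrite -size_poly_eq0 szP.
have lc0 : lead_coef P != 0 by rewrite lead_coef_eq0.
have szrs : size rs = n.
  by have := szP; rewrite PE size_scale // size_prod_XsubC; case.
have rsz a : a \in rs -> cmod a < cmod z.
  by move=> ars; apply: Pz; rewrite PE rootZ // root_prod_XsubC.
have zrs : z \notin rs by apply/negP => /rsz; rewrite ltxx.
have [] := deriv_prod_XsubC zrs.
set p := \prod_(a <- rs) _ in PE *.
set S1 := \sum_(a <- rs) _; set S2 := \sum_(a <- rs) _ => p1 p2.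
have pz0 : p.[z] != 0 by have := zrs; rewrite -root_prod_XsubC /root.
pose h : K[i] := n%:R / 2.
have BE : (Bop n l0 l1 l2 P).[z] = lead_coef P * p.[z] *
    (l0 + l1 * (h * z * S1) + l2 / 2 * ((h * z * S1) ^+ 2 - (h * z) ^+ 2 * S2)).
  by rewrite BopE {1 2 3}PE !derivZ !hornerZ p1 p2 -/h; field.
rewrite BE !mulf_neq0 //; clear BE.
(* The Moebius map [a -> x a] sends the disc [cmod a < cmod z] into the half
   plane [complex.Re t > n / 4]. *)
pose x a := h * z / (z - a).
have sigma : \sum_(a <- rs) x a = h * z * S1 by rewrite mulr_sumr.
have sigma2 : \sum_(a <- rs) x a ^+ 2 = (h * z) ^+ 2 * S2.
  by rewrite mulr_sumr; apply: eq_bigr => a _; rewrite exprMn.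
rewrite -sigma -sigma2; set X1 := \sum_(a <- rs) x a; set X2 := \sum_(a <- rs) _.
have n0K : 0 < n%:R / 2 :> K by rewrite divr_gt0 ?ltr0n.
have hE : h = (n%:R / 2)%:C by rewrite /h rmorphM fmorphV /= !rmorph_nat.
have h0 : h != 0 by rewrite hE fmorph_eq0 gt_eqF.
have xa a : a \in rs -> n%:R / 4 < complex.Re (x a).
  move=> ars; have za : z - a != 0.
    by rewrite subr_eq0; apply: contraNneq zrs => ->.
  have : ~~ (cmod (x a) <= cmod (x a - (n%:R / 2)%:C)).
    rewrite -hE (_ : x a - h = h * a / (z - a)); last by rewrite /x; field.
    rewrite -ltNge /x [ltLHS]cmodM [ltRHS]cmodM ltr_pM2r ?cmodV ?invr_gt0 ?cmod_gt0 //.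
    by rewrite !(cmodM h) ltr_pM2l ?cmod_gt0 // rsz.
  by rewrite half_planeE // -ltNge; lra.
have ReX1 : n%:R * (n%:R / 4) < complex.Re X1.
  rewrite /X1 -[\sum_(a <- rs) _](big_map x xpredT id) Re_sum big_map.
  set q : K := n%:R / 4 in xa *; rewrite -szrs.
  have : rs != [::] by rewrite -size_eq0 szrs -lt0n.
  clear -xa; elim: rs xa => [//|a [|b r] IH] xa _; last first.
    rewrite big_cons [size _]/= -natr1 mulrDl mul1r addrC ltrD ?xa ?mem_head //.
    by apply: IH => // c cr; apply: xa; rewrite inE cr orbT.
  by rewrite big_cons big_nil addr0 mul1r xa ?mem_head.
have nC : n%:R != 0 :> K[i] by rewrite pnatr_eq0 -lt0n.
have mean : n%:R / 4 < complex.Re (X1 / n%:R).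
  by rewrite Re_divn ltr_pdivlMr ?ltr0n // mulrC.
(* If [upoly] is affine, it takes the value considered at the mean of [x a];
   for [n = 1] this is so whatever [l2], the term in [l2] being zero. *)
have [l20|l20] := eqVneq ('C(n, 2)%:R * l2) 0.
  have := unz _ mean; rewrite l20 mul0r addr0.
  rewrite (_ : n%:R * l1 * (X1 / n%:R) = l1 * X1); last by field.
  suff -> : l2 / 2 * (X1 ^+ 2 - X2) = 0 by rewrite addr0.
  move/eqP: l20; rewrite mulf_eq0 pnatr_eq0 => /orP[|/eqP->]; last by rewrite !mul0r.
  rewrite -leqn0 leqNgt bin_gt0 -ltnNge ltnS => n1.
  rewrite /X1 /X2; case: (rs) szrs => [|a [|b r]] /= sz; last by move: n1; rewrite -sz.
    by move: n0; rewrite -sz.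
  by rewrite !big_cons !big_nil !addr0 subrr mulr0.
have n2 : (1 < n)%N.
  by rewrite -bin_gt0 lt0n; apply: contraNneq l20 => ->; rewrite mul0r.
have [t1 [t2 [l0E l1E]]] := quadratic_split (n%:R * l1) l0 l20.
have uE t : l0 + n%:R * l1 * t + 'C(n, 2)%:R * l2 * t ^+ 2
    = 'C(n, 2)%:R * l2 * ((t - t1) * (t - t2)).
  by rewrite l0E l1E; ring.
have tle t : (t - t1) * (t - t2) = 0 -> complex.Re t <= n%:R / 4.
  move=> t0; rewrite leNgt; apply/negP => /unz.
  by rewrite uE t0 mulr0 eqxx.
have t1n := tle t1; have t2n := tle t2.
rewrite !subrr mul0r in t1n; rewrite subrr mulr0 in t2n.
move: (t1n erefl) (t2n erefl) => {}t1n {}t2n.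
pose c := (t1 + t2) / 2; pose d := (t1 - t2) / 2.
have l2n : l2 != 0 by apply: contraNneq l20 => ->; rewrite mulr0.
have bE : 'C(n, 2)%:R = n%:R * (n%:R - 1) / 2 :> K[i] by exact: bin2_natr.
have l1E' : l1 = - (l2 * (n%:R - 1) * c).
  by apply: (mulfI nC); rewrite l1E bE /c; field.
have Zd w : w \in [seq x a - c | a <- rs] -> `|complex.Re d| < complex.Re w.
  case/mapP => a ars ->; have := xa a ars; rewrite /d /c.
  have ReB (u v : K[i]) : complex.Re (u - v) = complex.Re u - complex.Re v.
    by case: u v => ? ? [? ?].
  rewrite ReB !Re_divn ReB.
  case: (x a) (t1) (t2) t1n t2n => [xr xi] [r1 i1] [r2 i2] /= t1n t2n xan.
  by rewrite ltr_norml; apply/andP; split; lra.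
have := lorentzian_neq0 _ Zd; rewrite size_map szrs => /(_ n2).
rewrite !big_map => q0.
have XE1 : \sum_(a <- rs) (x a - c) = X1 - n%:R * c.
  by rewrite big_split /= -szrs sumrN big_const_seq count_predT iter_addr_0 mulr_natl.
have XE2 : \sum_(a <- rs) (x a - c) ^+ 2 = X2 - 2 * c * X1 + n%:R * c ^+ 2.
  rewrite /X1 /X2 -szrs; elim: (rs) => [|a r IH]; first by rewrite !big_nil /=; ring.
  by rewrite !big_cons IH /= -natr1; ring.
rewrite XE1 XE2 in q0.
have l22 : l2 / 2 != 0 by rewrite mulf_neq0 // invr_eq0 pnatr_eq0.
apply: contraNneq q0 => V0; apply/eqP/(mulfI l22).
by rewrite mulr0 -V0 l0E l1E' bE /c /d; field.
Qed.

(** * Comparison of [Bop P] and [Bop Q] *)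

Lemma BopB (K : realType) n (l0 l1 l2 : K[i]) P Q a z :
  (Bop n l0 l1 l2 (P - a *: Q)).[z]
    = (Bop n l0 l1 l2 P).[z] - a * (Bop n l0 l1 l2 Q).[z].
Proof. by rewrite !BopE !derivB !derivZ !hornerE /=; ring. Qed.

Lemma BopDC (K : realType) n (l0 l1 l2 : K[i]) P c z :
  (Bop n l0 l1 l2 (P + c%:P)).[z] = (Bop n l0 l1 l2 P).[z] + l0 * c.
Proof.
rewrite !BopE derivD derivC addr0.
by rewrite hornerD hornerC; ring.
Qed.

Lemma BopXn (K : realType) n (l0 l1 l2 : K[i]) z :
  (Bop n l0 l1 l2 'X^n).[z]
    = (l0 + n%:R * l1 * (n%:R / 2) + 'C(n, 2)%:R * l2 * (n%:R / 2) ^+ 2) * z ^+ n.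
Proof.
have dX k (x : K[i]) : x * ('X^k)^`().[x] = k%:R * x ^+ k.
  rewrite derivXn hornerMn hornerXn mulrnAr [RHS]mulr_natl.
  by case: k => [|k]; rewrite ?mulr0n // -exprS.
have ddX : z ^+ 2 * ('X^n)^`()^`().[z] = n%:R * (n%:R - 1) * z ^+ n.
  rewrite derivXn derivMn hornerMn mulrnAr expr2 -mulrA dX.
  case: n => [|n]; first by rewrite mulr0n !mul0r.
  by rewrite exprS -[_ *+ n.+1]mulr_natr -natr1 addrK /=; ring.
rewrite BopE bin2_natr hornerXn -[_ * z * _]mulrA dX exprMn -[_ ^+ 2 * _ * _]mulrA.
by rewrite [z ^+ 2 * _]mulrA ddX; field.
Qed.

(** [Bop] commutes with dilations, since it only involves the
    scale-invariant operators [z ^+ k * d^k / dz^k]. *)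
Lemma Bop_dilate (K : realType) n (l0 l1 l2 : K[i]) r P z :
  (Bop n l0 l1 l2 (dilate r P)).[z] = (Bop n l0 l1 l2 P).[r%:C * z].
Proof.
have dd (R : {poly K[i]}) : (dilate r R)^`() = r%:C *: dilate r R^`().
  by rewrite /dilate deriv_comp derivZ derivX -mulr_algr mulrC alg_polyC mul_polyC.
have hd (R : {poly K[i]}) : (dilate r R).[z] = R.[r%:C * z].
  by rewrite /dilate horner_comp !hornerE.
rewrite !BopE !dd derivZ dd !hornerZ !hd; ring.
Qed.

(** Continuity of [f] at [z] along the ray through [z], which is all that is
    needed to extend an inequality from [cmod w > 1] to [cmod w >= 1]. *)
Lemma horner_lipschitz_radial (K : realType) (f : {poly K[i]}) (z : K[i]) :
  exists2 C : K, 0 <= C & forall e, 0 <= e -> e <= 1 ->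
    cmod (f.[(1 + e)%:C * z] - f.[z]) <= C * e.
Proof.
elim/poly_ind: f => [|f c [C C0 IH]].
  by exists 0 => // e _ _; rewrite !horner0 subrr cmod0 mul0r.
exists (2 * C * cmod z + cmod f.[z] * cmod z).
  by rewrite addr_ge0 ?mulr_ge0 ?cmod_ge0.
move=> e e0 e1; rewrite !hornerD !hornerMX !hornerC.
set w := (1 + e)%:C * z.
rewrite (_ : _ - _ = (f.[w] - f.[z]) * w + f.[z] * (e%:C * z)); last first.
  have -> : e%:C * z = w - z by rewrite /w rmorphD rmorph1 /=; ring.
  by ring.
have := IH e e0 e1; rewrite -/w => fe.
apply: le_trans (ler_cmodD _ _) _.
have wE : cmod w = (1 + e) * cmod z by rewrite /w cmodM cmod_real //; lra.
rewrite (cmodM _ w) wE (cmodM f.[z]) (cmodM e%:C) cmod_real //.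
rewrite [leRHS]mulrDl; apply: lerD; last by rewrite [leRHS]mulrAC mulrA mulrAC.
have z0 := cmod_ge0 z.
apply: le_trans (ler_wpM2r _ fe) _; first by rewrite mulr_ge0 //; lra.
have -> : 2 * C * cmod z * e = C * e * (2 * cmod z) by ring.
by rewrite ler_wpM2l ?mulr_ge0 // ler_wpM2r //; lra.
Qed.

Lemma le_closed_exterior (K : realType) (f g : {poly K[i]}) :
  (forall w : K[i], 1 < cmod w -> cmod f.[w] <= cmod g.[w]) ->
  forall w : K[i], 1 <= cmod w -> cmod f.[w] <= cmod g.[w].
Proof.
move=> fg w w1.
have [C C0 fC] := horner_lipschitz_radial f w.
have [D D0 gD] := horner_lipschitz_radial g w.
apply/ler_addgt0Pr => d d0.
have CD : 0 < d + (C + D) by lra.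
(* small enough for [e <= 1] and [(C + D) * e <= d] *)
pose e := d / (d + (C + D)).
have e0 : 0 < e by rewrite divr_gt0.
have e1 : e <= 1 by rewrite ler_pdivrMr //; lra.
have ed : (C + D) * e <= d.
  by rewrite /e mulrCA ger_pMr // ler_pdivrMr //; lra.
have := fC e (ltW e0) e1; have := gD e (ltW e0) e1.
set v := (1 + e)%:C * w => gv fv.
have v1 : 1 < cmod v.
  by rewrite cmodM cmod_real; [nra|lra].
have h1 := fg v v1.
have := ler_cmodD (f.[w] - f.[v]) f.[v]; rewrite subrK -[cmod (_ - _)]cmodN opprB => h2.
have := ler_cmodD (g.[v] - g.[w]) g.[w]; rewrite subrK => h3.
lra.
Qed.

(** The constant [a] is the quotient of the two values of [Bop]: if it had
    modulus larger than [1], [P - a *: Q] would contradict [Bop_neq0]. The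
    hypothesis on the coefficients keeps the degree of [P - a *: Q] equal
    to [n]. *)
Lemma Bop_le (K : realType) n (l0 l1 l2 : K[i]) :
  (1 <= n)%N ->
  (forall z : K[i], root (upoly n l0 l1 l2) z ->
     cmod z <= cmod (z - n%:R / 2%:R)) ->
  forall P Q : {poly K[i]}, (size P <= n.+1)%N -> size Q = n.+1 ->
    (forall w, root Q w -> cmod w <= 1) -> cmod P`_n <= cmod Q`_n ->
    (forall w, 1 < cmod w -> cmod P.[w] <= cmod Q.[w]) ->
  forall z : K[i], 1 <= cmod z ->
    cmod (Bop n l0 l1 l2 P).[z] <= cmod (Bop n l0 l1 l2 Q).[z].
Proof.
move=> n0 hu P Q szP szQ Q1 PQn PQ; apply: le_closed_exterior => z z1.
have BQ0 : (Bop n l0 l1 l2 Q).[z] != 0.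
  by apply: Bop_neq0 => // w /Q1 w1; apply: le_lt_trans w1 z1.
rewrite leNgt; apply/negP => BPQ.
pose a := (Bop n l0 l1 l2 P).[z] / (Bop n l0 l1 l2 Q).[z].
have a1 : 1 < cmod a.
  by rewrite /a cmodM cmodV ltr_pdivlMr ?mul1r // cmod_gt0.
have Qn0 : Q`_n != 0.
  have <- : lead_coef Q = Q`_n by rewrite /lead_coef szQ.
  by rewrite lead_coef_eq0 -size_poly_eq0 szQ.
have neq (x y : K[i]) : y != 0 -> cmod x <= cmod y -> x - a * y != 0.
  move=> y0 xy; rewrite subr_eq0; apply: contraTneq xy => ->.
  by rewrite -ltNge cmodM ltr_pMl // cmod_gt0.
have szPQ : size (P - a *: Q) = n.+1.
  apply/eqP; rewrite eqn_leq; apply/andP; split.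
    rewrite (leq_trans (size_polyD _ _)) // geq_max szP size_polyN.
    by rewrite (leq_trans (size_scale_leq _ _)) // szQ.
  rewrite ltnNge; apply: contra (neq _ _ Qn0 PQn) => sz.
  by rewrite -coefZ -coefB nth_default.
suff : (Bop n l0 l1 l2 (P - a *: Q)).[z] != 0 by rewrite BopB divfK // subrr eqxx.
apply: Bop_neq0 => // w; rewrite /root !hornerE => rw.
apply: le_lt_trans z1; rewrite leNgt; apply/negP => w1.
have Qw : Q.[w] != 0 by apply: contraTN w1 => Qw; rewrite -leNgt Q1.
by move: (neq _ _ Qw (PQ w w1)); rewrite rw.
Qed.

(** * The conjugate reciprocal polynomial *)

(** The conjugate reciprocal [w ^+ n * conjc (P (1 / conjc w))]: it has the
    modulus of [P] on the unit circle, and its zeros are those of [P] reflected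
    in that circle. *)
Definition recip (K : realType) n (P : {poly K[i]}) : {poly K[i]} :=
  \poly_(i < n.+1) conjc P`_(n - i).

Lemma horner_recip (K : realType) n (P : {poly K[i]}) (w : K[i]) :
  (size P <= n.+1)%N -> w != 0 ->
  (recip n P).[w] = w ^+ n * conjc P.[(conjc w)^-1].
Proof.
move=> szP w0; rewrite horner_poly (horner_coef_wide _ szP) rmorph_sum mulr_sumr.
rewrite (reindex_inj rev_ord_inj) /=; apply: eq_bigr => i _.
rewrite subSS subKn -1?ltnS // rmorphM rmorphXn fmorphV /= conjcK.
rewrite mulrCA; congr (_ * _).
have -> : w ^+ n = w ^+ (n - i) * w ^+ i by rewrite -exprD subnK // -ltnS.
by rewrite exprVn mulfK // expf_neq0.
Qed.

Lemma cmod_horner_recip (K : realType) n (P : {poly K[i]}) (w : K[i]) :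
  (size P <= n.+1)%N -> w != 0 ->
  cmod (recip n P).[w] = cmod w ^+ n * cmod P.[(conjc w)^-1].
Proof. by move=> szP w0; rewrite horner_recip // cmodM cmodX cmodJ. Qed.

Lemma size_recip (K : realType) n (P : {poly K[i]}) :
  P`_0 != 0 -> size (recip n P) = n.+1.
Proof. by move=> P0; rewrite size_poly_eq // subnn conjc_eq0. Qed.

Lemma exterior_neq0 (K : realType) (w : K[i]) : 1 < cmod w -> w != 0.
Proof. by move=> w1; rewrite -cmod_gt0; apply: lt_trans w1. Qed.

Lemma root_recip (K : realType) n (P : {poly K[i]}) :
  (size P <= n.+1)%N -> (forall z : K[i], cmod z < 1 -> P.[z] != 0) ->
  forall w, root (recip n P) w -> cmod w <= 1.
Proof.
move=> szP Pnz w rw; rewrite leNgt; apply/negP => w1.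
have w0 := exterior_neq0 w1.
have := rw; rewrite /root -cmod_eq0 cmod_horner_recip // mulf_eq0.
rewrite expf_eq0 cmod_eq0 (negPf w0) andbF cmod_eq0 /=; apply/negP/Pnz.
by rewrite cmodV cmodJ invf_lt1 // (lt_trans _ w1).
Qed.

Lemma split_exterior (K : realType) (P : {poly K[i]}) :
  P != 0 -> (forall z : K[i], cmod z < 1 -> P.[z] != 0) ->
  exists rs : seq K[i], [/\ (size P = (size rs).+1)%N,
    P = lead_coef P *: \prod_(a <- rs) ('X - a%:P) &
    forall a, a \in rs -> 1 <= cmod a].
Proof.
move=> P0 Pnz; have [rs PE] := closed_field_poly_normal P.
have lc0 : lead_coef P != 0 by rewrite lead_coef_eq0.
exists rs; split=> //; first by rewrite PE size_scale // size_prod_XsubC.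
move=> a ars; rewrite leNgt; apply/negP => /Pnz.
by rewrite -/(root P a) PE rootZ // root_prod_XsubC ars.
Qed.

(** Factor by factor, the inequality is
    [cmod (1 - conjc w * a) ^+ 2 - cmod (w - a) ^+ 2
       = (cmod a ^+ 2 - 1) * (cmod w ^+ 2 - 1)]. *)
Lemma le_recip (K : realType) n (P : {poly K[i]}) :
  size P = n.+1 -> (forall z : K[i], cmod z < 1 -> P.[z] != 0) ->
  forall w, 1 < cmod w -> cmod P.[w] <= cmod (recip n P).[w].
Proof.
move=> szP Pnz w w1; have w0 := exterior_neq0 w1.
have P0 : P != 0 by rewrite -size_poly_eq0 szP.
rewrite cmod_horner_recip ?szP //.
have [rs [szrs PE rs1]] := split_exterior P0 Pnz.
have -> : n = size rs by move: szrs; rewrite szP => -[].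
rewrite PE !hornerZ !cmodM mulrCA ler_wpM2l ?cmod_ge0 //.
elim: rs rs1 {szrs PE} => [|a rs IH] rs1; first by rewrite big_nil !hornerC expr0 mul1r.
rewrite big_cons !hornerM !cmodM !hornerXsubC /= exprS mulrACA.
apply: ler_pM; rewrite ?cmod_ge0 //; last first.
  by apply: IH => b brs; rewrite rs1 // inE brs orbT.
rewrite -(cmodJ w) -cmodM mulrBr divff ?conjc_eq0 //.
have a1 : 1 <= cmod a by rewrite rs1 ?mem_head.
rewrite ler_cmod_sqr -subr_ge0.
have -> : cmod (1 - conjc w * a) ^+ 2 - cmod (w - a) ^+ 2
    = (cmod a ^+ 2 - 1) * (cmod w ^+ 2 - 1).
  by rewrite !sqr_cmod; case: (w) (a) => [x y] [u v] /=; ring.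
by rewrite mulr_ge0 // subr_ge0 exprn_ege1 // ltW.
Qed.

(** The constant coefficient is the leading one times the product of the zeros,
    up to sign. *)
Lemma coef_le_recip (K : realType) n (P : {poly K[i]}) :
  size P = n.+1 -> (forall z : K[i], cmod z < 1 -> P.[z] != 0) ->
  cmod P`_n <= cmod (recip n P)`_n.
Proof.
move=> szP Pnz; have P0 : P != 0 by rewrite -size_poly_eq0 szP.
rewrite coef_poly ltnSn subnn cmodJ -horner_coef0.
have -> : P`_n = lead_coef P by rewrite /lead_coef szP.
have [rs [_ PE rs1]] := split_exterior P0 Pnz.
rewrite [in leRHS]PE hornerZ cmodM ler_peMr ?cmod_ge0 //.
elim: rs rs1 {PE} => [|a rs IH] rs1; first by rewrite big_nil hornerC cmod1.
rewrite big_cons hornerM cmodM hornerXsubC sub0r cmodN.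
apply: mulr_ege1; first by rewrite rs1 ?mem_head.
by apply: IH => b brs; rewrite rs1 // inE brs orbT.
Qed.

Lemma Bop_le_recip (K : realType) n (l0 l1 l2 : K[i]) :
  (1 <= n)%N ->
  (forall z : K[i], root (upoly n l0 l1 l2) z ->
     cmod z <= cmod (z - n%:R / 2%:R)) ->
  forall P : {poly K[i]}, size P = n.+1 ->
    (forall z : K[i], cmod z < 1 -> P.[z] != 0) ->
  forall z : K[i], 1 <= cmod z ->
    cmod (Bop n l0 l1 l2 P).[z] <= cmod (Bop n l0 l1 l2 (recip n P)).[z].
Proof.
move=> n0 hu P szP Pnz; apply: Bop_le => //; rewrite ?szP //.
- by rewrite size_recip // -horner_coef0 Pnz // cmod0.
- by apply: root_recip; rewrite ?szP.
- exact: coef_le_recip.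
- exact: le_recip.
Qed.

(** Bernstein's inequality for [Bop], by comparison with [M%:C *: 'X^n]: at
    [cmod w > 1] the modulus of [recip n P] is [cmod w ^+ n] times that of [P]
    at a point of the disc, where the maximum modulus principle applies. *)
Lemma Bop_recip_bernstein (K : realType) n (l0 l1 l2 : K[i]) :
  (1 <= n)%N ->
  (forall z : K[i], root (upoly n l0 l1 l2) z ->
     cmod z <= cmod (z - n%:R / 2%:R)) ->
  forall (P : {poly K[i]}) (M : K), (size P <= n.+1)%N -> 0 < M ->
    (forall w, cmod w = 1 -> cmod P.[w] <= M) ->
  forall z : K[i], 1 <= cmod z ->
    cmod (Bop n l0 l1 l2 (recip n P)).[z] <= M * cmod (Bop n l0 l1 l2 'X^n).[z].
Proof.
move=> n0 hu P M szP M0 PM z z1.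
have MC : M%:C != 0 by rewrite fmorph_eq0 gt_eqF.
have -> : M * cmod (Bop n l0 l1 l2 'X^n).[z]
    = cmod (Bop n l0 l1 l2 (M%:C *: 'X^n)).[z].
  rewrite -[M in LHS]cmod_real ?(ltW M0) // -cmodM; congr cmod.
  by rewrite !BopE !derivZ !hornerZ; ring.
apply: Bop_le => //.
- exact: size_poly.
- by rewrite size_scale // size_polyXn.
- by move=> w; rewrite rootZ // /root hornerXn expf_eq0 => /andP[_ /eqP->]; rewrite cmod0.
- rewrite coefZ coefXn eqxx mulr1 cmod_real ?(ltW M0) // coef_poly ltnSn subnn cmodJ.
  exact: coef_le_circle.
- move=> w w1; have w0 := exterior_neq0 w1.
  rewrite cmod_horner_recip // hornerZ hornerXn cmodM cmodX cmod_real ?(ltW M0) // mulrC.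
  rewrite ler_wpM2r ?exprn_ge0 ?cmod_ge0 //; apply: maximum_modulus => //.
  by rewrite cmodV cmodJ invf_le1 ?ltW // (lt_trans _ w1).
Qed.

(** By the maximum modulus principle [P + c] has no zero in the disc when
    [cmod c = rho * M] with [rho > 1]. [Bop_le_recip] then compares
    [Bop P + l0 * c] with [Bop (recip n P) + conjc c * Bop 'X^n]. The argument
    of [c] is chosen so that the two terms of the latter have opposite
    directions; the second being the larger one, the modulus of the sum is the
    difference of the moduli. Finally [rho] tends to [1]. *)
Lemma Bop_add_recip_le (K : realType) n (l0 l1 l2 : K[i]) :
  (1 <= n)%N ->
  (forall z : K[i], root (upoly n l0 l1 l2) z ->
     cmod z <= cmod (z - n%:R / 2%:R)) ->
  forall (P : {poly K[i]}) (M : K), size P = n.+1 -> 0 < M ->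
    (forall w, cmod w = 1 -> cmod P.[w] <= M) ->
  forall z : K[i], 1 <= cmod z ->
    cmod (Bop n l0 l1 l2 P).[z] + cmod (Bop n l0 l1 l2 (recip n P)).[z]
      <= (cmod (Bop n l0 l1 l2 'X^n).[z] + cmod l0) * M.
Proof.
move=> n0 hu P M szP M0 PM z z1.
have := Bop_recip_bernstein n0 hu (eq_leq szP) M0 PM z1.
set BP := (Bop n l0 l1 l2 P).[z]; set BQ := (Bop n l0 l1 l2 (recip n P)).[z].
set E := (Bop n l0 l1 l2 'X^n).[z] => BQE.
pose T := (cmod E + cmod l0) * M.
have T0 : 0 <= T by rewrite mulr_ge0 ?addr_ge0 ?cmod_ge0 // ltW.
suff rhoT rho : 1 < rho -> cmod BP + cmod BQ <= rho * T.
  apply/ler_addgt0Pr => e e0; rewrite -/T.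
  have := rhoT (1 + e / (T + 1)); rewrite ltrDl divr_gt0 //; last by lra.
  move=> /(_ isT) /le_trans; apply.
  rewrite mulrDl mul1r lerD2l -mulrA ger_pMr // mulrC ler_pdivrMr; lra.
move=> rho1.
have [a [a1 aE]] := cmod_phase BQ; have [b [b1 bE]] := cmod_phase E.
have a0 : a != 0 by rewrite -cmod_gt0 a1.
have b0 : b != 0 by rewrite -cmod_gt0 b1.
(* [a] and [b] are the directions of [BQ] and [E]: [conjc c * E] gets the
   direction [- a]. *)
pose c : K[i] := (rho * M)%:C * conjc (- (a / b)).
have rM0 : 0 <= rho * M by rewrite mulr_ge0 //; lra.
have cc : cmod c = rho * M.
  by rewrite cmodM cmod_real // cmodJ cmodN cmodM cmodV a1 b1 invr1 !mulr1.
pose F := P + c%:P.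
have szF : size F = n.+1.
  by rewrite size_polyDl // szP (leq_ltn_trans (size_polyC_leq1 _)).
have Fnz w : cmod w < 1 -> F.[w] != 0.
  move=> w1; rewrite hornerD hornerC addr_eq0; apply/eqP => Pw.
  have := maximum_modulus PM (ltW w1); rewrite Pw cmodN cc.
  by rewrite leNgt ltr_pMl ?rho1.
have FE : recip n F = recip n P - (- conjc c) *: 'X^n.
  apply/polyP => i; rewrite coefB coefZ coefXn !coef_poly coefD coefC.
  have [i_n|i_n] := ltnP i n.+1; last first.
    by rewrite [i == n]gtn_eqF // mulr0 subr0.
  rewrite rmorphD /=; have [->|ni] := eqVneq i n.
    by rewrite subnn eqxx mulr1 opprK.
  have -> : (n - i == 0)%N = false.
    by rewrite subn_eq0 leqNgt ltn_neqAle ni -ltnS i_n.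
  by rewrite conjc0 mulr0 subr0 addr0.
have := Bop_le_recip n0 hu szF Fnz z1; rewrite FE BopB BopDC -/BP -/BQ -/E.
have -> : BQ - - conjc c * E = (rho * M * cmod E - cmod BQ)%:C * - a.
  have -> : conjc c = (rho * M)%:C * - (a / b).
    by rewrite /c [LHS]rmorphM /= conjcK oppr0.
  rewrite {1}aE {1}bE rmorphB !rmorphM /=.
  by field.
have BQ_le : 0 <= rho * M * cmod E - cmod BQ.
  rewrite subr_ge0 -mulrA; apply: le_trans BQE _.
  by rewrite ler_peMl ?(ltW rho1) // mulr_ge0 ?cmod_ge0 // ltW.
rewrite [leRHS]cmodM cmodN a1 mulr1 cmod_real //.
have := ler_cmodB BP (l0 * c); rewrite cmodM cc /T; lra.
Qed.

(** * The maximum on the unit circle *)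

Lemma le_max_circle (K : realType) (P : {poly K[i]}) (w : K[i]) :
  cmod w = 1 -> cmod P.[w] <= max_circle P.
Proof.
move=> w1; apply: ub_le_sup; last by exists w.
exists (\sum_(i < size P) cmod P`_i) => _ [v v1 <-].
rewrite horner_coef; apply: le_trans (ler_cmod_sum _ _) _.
by apply: ler_sum => i _; rewrite cmodM cmodX v1 expr1n mulr1.
Qed.

Lemma max_circle_Xn1 (K : realType) n : max_circle ('X^n + 1 : {poly K[i]}) = 2.
Proof.
apply/eqP; rewrite eq_le; apply/andP; split.
  apply: ge_sup.
    by exists (cmod ('X^n + 1 : {poly K[i]}).[1]); exists 1 => //=; rewrite cmod1.
  move=> _ [w w1 <-]; rewrite hornerD hornerXn hornerC.
  by apply: le_trans (ler_cmodD _ _) _; rewrite cmodX w1 expr1n cmod1.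
have := @le_max_circle K ('X^n + 1) 1 (cmod1 K).
by rewrite hornerD hornerXn hornerC expr1n -[1 + 1]/(2%:R) cmod_nat.
Qed.

(** * The sharp bound *)

Theorem corollary2 (K : realType) (n : nat) (hn : (1 <= n)%N)
    (l0 l1 l2 : K[i])
    (hu : forall z : K[i], root (upoly n l0 l1 l2) z ->
            cmod z <= cmod (z - n%:R / 2%:R)) :
  (forall P : {poly K[i]},
     size P = n.+1 ->
     (forall z : K[i], cmod z < 1 -> P.[z] != 0) ->
     forall (r : K) (z : K[i]), 1 <= r -> 1 <= cmod z ->
       cmod (Bop n l0 l1 l2 (dilate r P)).[z]
       <= 1 / 2%:R
          * (r ^+ n * cmod (Bop n l0 l1 l2 'X^n).[z] + cmod l0)
          * max_circle P)
  /\
  (forall r : K, 1 <= r ->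
     exists z : K[i], 1 <= cmod z /\
       cmod (Bop n l0 l1 l2 (dilate r ('X^n + 1))).[z]
       = 1 / 2%:R
         * (r ^+ n * cmod (Bop n l0 l1 l2 'X^n).[z] + cmod l0)
         * max_circle ('X^n + 1)).
Proof.
split=> [P szP Pnz r z r1 z1|r r1]; have r0 : 0 <= r by lra.
- rewrite Bop_dilate; set w := r%:C * z.
  have w1 : 1 <= cmod w by rewrite cmodM cmod_real //; nra.
  have M0 : 0 < max_circle P.
    apply: lt_le_trans (_ : cmod P`_0 <= _).
      by rewrite cmod_gt0 -horner_coef0 Pnz // cmod0.
    by apply: coef_le_circle => v; apply: le_max_circle.
  have := Bop_add_recip_le hn hu szP M0 (@le_max_circle K P) w1.
  have := Bop_le_recip hn hu szP Pnz w1.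
  have -> : cmod (Bop n l0 l1 l2 'X^n).[w]
      = r ^+ n * cmod (Bop n l0 l1 l2 'X^n).[z].
    rewrite !BopXn !(cmodM (_ + _)) !cmodX /w (cmodM r%:C) cmod_real //.
    by rewrite (exprMn _ r) [LHS]mulrCA.
  lra.
- set U := l0 + n%:R * l1 * (n%:R / 2) + 'C(n, 2)%:R * l2 * (n%:R / 2) ^+ 2.
  have [a [a1 UE]] := cmod_phase U; have [b [b1 l0E]] := cmod_phase l0.
  have a0 : a != 0 by rewrite -cmod_gt0 a1.
  (* [a] and [b] are the directions of [U] and [l0], so that this [z] gives
     [r ^+ n * U * z ^+ n] the direction of [l0]. *)
  pose z : K[i] := n.-root (b / a).
  have zn : z ^+ n = b / a by rewrite rootCK.
  have z1 : cmod z = 1.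
    apply/eqP; rewrite -(@pexpr_eq1 _ _ n) ?cmod_ge0 // -cmodX zn.
    by rewrite cmodM cmodV a1 b1 divr1.
  exists z; split; first by rewrite z1.
  rewrite max_circle_Xn1 Bop_dilate BopDC !BopXn -/U exprMn zn.
  have -> : U * (r%:C ^+ n * (b / a)) + l0 * 1
      = (r ^+ n * cmod U + cmod l0)%:C * b.
    rewrite {1}UE {1}l0E rmorphD rmorphM rmorphXn /=; field.
    exact: a0.
  rewrite !cmodM b1 cmodV a1 cmod_real ?addr_ge0 ?mulr_ge0 ?exprn_ge0 ?cmod_ge0 //.
  by field.
Qed.
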